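(* For any DAG $G^*=(V,E)$ with vertex weights $w:V\to\mathbb{R}_{\ge0}$, \[ \overline{\nu}^{\max}_1(G^* ) \;\ge\; \max_{\mathcal{I}\subseteq V}\ \sum_{\substack{H\in CC(\mathcal{E}_{\mathcal{I}}(G^* ))\\ |V(H)|\ge 2}} \max\{\zeta^{(1)}_{\mathcal{I},H},\zeta^{(2)}_{\mathcal{I},H}\}, \] where the maximum is over atomic intervention sets $\mathcal{I}\subseteq V$, \[ \zeta^{(1)}_{\mathcal{I},H}=\tfrac12\max_{\text{clique } C \text{ of } H}\Big\{ w(V(C)) - \max_{v\in V(C)} w(v)\Big\}, \qquad \zeta^{(2)}_{\mathcal{I},H}=\tfrac12\max_{v\in V(H)} \min\{ w(v),\gamma_{H,v}\}, \] and $\gamma_{H,v}=\sum_{i=1}^t \max\{ w(V(C_i)) : C_i \text{ a clique of } H \text{ with } V(C_i)\subseteq V_i\cap N_H(v)\}$, where $V_1,\dots,V_t$ ($t\ge1$) are the vertex sets of the connected components of $H[V(H)\setminus\{v\}]$ and $N_H(v)$ is the neighborhood of $v$ in $H$.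
   Context: A v-structure is a triple $u\to x\leftarrow y$ with $u,y$ nonadjacent. $[G^*]$ is the Markov equivalence class of $G^*$ (DAGs with the same skeleton and v-structures). An intervention is a subset $S\subseteq V$; an atomic intervention set is identified with a subset $\mathcal{I}\subseteq V$ (each vertex intervened on individually), with cost $w(\mathcal{I})=\sum_{v\in\mathcal{I}}w(v)$; for a set $U$, $w(U)=\sum_{u\in U}w(u)$. The $\mathcal{I}$-essential graph $\mathcal{E}_{\mathcal{I}}(G)$ is obtained from the skeleton of $G$ by orienting, as in $G$, every edge belonging to a v-structure and every edge with exactly one endpoint in some intervention of $\mathcal{I}$, then applying Meek rules R1–R4 until no further edge can be oriented (R1: $a - b$ becomes $a\to b$ if $c\to a$, $c,b$ nonadjacent; R2: if $a\to c\to b$; R3: if $d - a - c$, $d\to b\leftarrow c$, $c,d$ nonadjacent; R4: if $d - a - c$, $d\to c\to b$, $b,d$ nonadjacent). $CC(\mathcal{E}_{\mathcal{I}}(G))$ is the set of chain components: connected components of the undirected graph obtained by deleting all directed edges of $\mathcal{E}_{\mathcal{I}}(G)$, each viewed as an undirected graph $H$. $\mathcal{I}$ is a verifying set for $G$ if $\mathcal{E}_{\mathcal{I}}(G)=G$. $\overline{\nu}_1(G)$ is the minimum cost of an atomic verifying set for $G$, and $\overline{\nu}^{\max}_1(G^* )=\max_{G\in[G^*]}\overline{\nu}_1(G)$. *)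

(* Defs.v *)
From HB Require Import structures.
From mathcomp Require Import all_boot all_order all_algebra.
Set Implicit Arguments.
Unset Strict Implicit.
Unset Printing Implicit Defensive.
Import Order.TTheory GRing.Theory Num.Theory.
Local Open Scope ring_scope.

Section Defs.
Variable T : finType.

Definition erel (G : {set T * T}) : rel T := fun u v => (u, v) \in G.

Definition adj (G : {set T * T}) (u v : T) : bool := erel G u v || erel G v u.

(* acyclicity: no directed cycle (this also excludes self-loops) *)
Definition dag (G : {set T * T}) : bool :=
  [forall u, forall v, erel G u v ==> ~~ connect (erel G) v u].

Definition vstruct (G : {set T * T}) (u x y : T) : bool :=
  [&& erel G u x, erel G y x, u != y & ~~ adj G u y].

Definition mec (G1 G2 : {set T * T}) : bool :=
  [&& dag G2,
      [forall u, forall v, adj G1 u v == adj G2 u v] &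
      [forall u, forall x, forall y, vstruct G1 u x y == vstruct G2 u x y]].

(* Partially directed graphs are encoded by a relation O : rel T:
   a -> b directed iff O a b && ~~ O b a; a - b undirected iff O a b && O b a;
   a, b adjacent iff O a b || O b a. *)
Definition dir (O : rel T) (a b : T) : bool := O a b && ~~ O b a.
Definition und (O : rel T) (a b : T) : bool := O a b && O b a.
Definition adjp (O : rel T) (a b : T) : bool := O a b || O b a.

(* Edge u -> v of G is initially oriented for the atomic intervention set I:
   one endpoint is intervened on (for atomic interventions "exactly one
   endpoint in some intervention {x}, x in I" means u \in I or v \in I),
   or the edge belongs to a v-structure. *)
Definition init_oriented (G : {set T * T}) (I : {set T}) (u v : T) : bool :=
  [|| u \in I, v \in I | [exists y, vstruct G u v y]].

Definition init_pdag (G : {set T * T}) (I : {set T}) : rel T :=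
  fun x y => erel G x y || (erel G y x && ~~ init_oriented G I y x).

Definition meekR1 (O : rel T) (a b : T) : bool :=
  [exists c, dir O c a && ~~ adjp O c b].
Definition meekR2 (O : rel T) (a b : T) : bool :=
  [exists c, dir O a c && dir O c b].
Definition meekR3 (O : rel T) (a b : T) : bool :=
  [exists c, exists d,
     [&& und O d a, und O a c, dir O d b, dir O c b, c != d & ~~ adjp O c d]].
Definition meekR4 (O : rel T) (a b : T) : bool :=
  [exists c, exists d,
     [&& und O d a, und O a c, dir O d c, dir O c b, b != d & ~~ adjp O b d]].

Definition meek_app (O : rel T) (a b : T) : bool :=
  und O a b && [|| meekR1 O a b, meekR2 O a b, meekR3 O a b | meekR4 O a b].

Definition meek_step (O : rel T) : rel T :=
  if [pick p : T * T | meek_app O p.1 p.2] is Some p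
  then fun x y => ~~ ((x == p.2) && (y == p.1)) && O x y
  else O.

(* Each effective step orients one more edge, so after #|T|^2 steps no
   rule applies any more: this is the Meek closure. *)
Definition meek_closure (O : rel T) : rel T := iter (#|T| ^ 2) meek_step O.

Definition essential (G : {set T * T}) (I : {set T}) : rel T :=
  meek_closure (init_pdag G I).

Definition verifying (G : {set T * T}) (I : {set T}) : bool :=
  [forall x, forall y, essential G I x y == erel G x y].

Variable R : realFieldType.
Variable w : T -> R.

Definition wset (C : {set T}) : R := \sum_(v in C) w v.

(* minimum cost of an atomic verifying set (V itself is always verifying,
   so the default value w(V) does not affect the minimum) *)
Definition nu1 (G : {set T * T}) : R :=
  \big[Num.min/wset setT]_(I : {set T} | verifying G I) wset I.

(* maximum over the Markov equivalence class (nonempty for a DAG; values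
   are >= 0 for nonnegative weights, so the default 0 is harmless) *)
Definition nu1max (Gs : {set T * T}) : R :=
  \big[Num.max/0]_(G : {set T * T} | mec Gs G) nu1 G.

Definition chain_comps (O : rel T) : {set {set T}} :=
  [set [set y | connect (und O) x y] | x : T].

Definition clique (U : rel T) (H C : {set T}) : bool :=
  (C \subset H) && [forall x in C, forall y in C, (x != y) ==> U x y].

Definition zeta1 (U : rel T) (H : {set T}) : R :=
  2^-1 * \big[Num.max/0]_(C : {set T} | clique U H C && (C != set0))
            (wset C - \big[Num.max/0]_(v in C) w v).

Definition induced (U : rel T) (S : {set T}) : rel T :=
  fun x y => [&& U x y, x \in S & y \in S].

Definition comps_minus (U : rel T) (H : {set T}) (v : T) : {set {set T}} :=
  [set [set y | connect (induced U (H :\ v)) x y] | x in H :\ v].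

Definition nbr (U : rel T) (H : {set T}) (v : T) : {set T} :=
  [set u in H | U v u].

Definition gamma (U : rel T) (H : {set T}) (v : T) : R :=
  \sum_(Vi in comps_minus U H v)
     \big[Num.max/0]_(C : {set T} | clique U H C && (C \subset Vi :&: nbr U H v))
        wset C.

Definition zeta2 (U : rel T) (H : {set T}) : R :=
  2^-1 * \big[Num.max/0]_(v in H) Num.min (w v) (gamma U H v).

Definition lower_bound (Gs : {set T * T}) : R :=
  \big[Num.max/0]_(I : {set T})
    \sum_(H in chain_comps (essential Gs I) | (1 < #|H|)%N)
       Num.max (zeta1 (und (essential Gs I)) H) (zeta2 (und (essential Gs I)) H).

End Defs.

(* Main.v *)
(** Every verifying set of a DAG meets all its covered edges, since reversing a covered
    edge that is disjoint from the set yields a Markov equivalent DAG that the Meek rules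
    cannot tell apart.  It thus suffices to find a member of the equivalence class whose
    covered edges are expensive to cover.  The essential graph is a chain graph with chordal
    chain components, so each component may be reoriented independently along any
    perfect elimination order.
    For zeta1, put the clique C first, by decreasing weight: consecutive vertices of C span
    covered edges, and covering this path costs at least half of w(C) minus its maximum.
    For zeta2, put v first and then each C_i by decreasing weight: the edge from v to the
    heaviest vertex of each C_i is also covered, so a cover contains v or all these
    vertices, and in the latter case costs at least half of every w(C_i). *)

Require Import Defs.
From HB Require Import structures.
From mathcomp Require Import all_boot all_order all_algebra.
From mathcomp Require Import zify lra.
Import Order.TTheory GRing.Theory Num.Theory.
Set Implicit Arguments.
Unset Strict Implicit.
Unset Printing Implicit Defensive.

(** * DAGs and Meek rules *)

Section Dags.
Variable T : finType.
Implicit Types (G D : {set T * T}) (O : rel T) (I : {set T}).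

(** Rank by the number of ancestors: along an arc those of the source are kept and, by acyclicity,
    the target itself is a new one. *)
Lemma dag_rank G : dag G -> exists g : T -> nat, forall x y, erel G x y -> g x < g y.
Proof.
move=> /forallP dG; exists (fun x => #|[set z | connect (erel G) z x]|) => x y xy.
apply: proper_card; apply/properP; split.
  by apply/subsetP => z; rewrite !inE => zx; apply: connect_trans zx (connect1 xy).
exists y; rewrite !inE ?connect0 //.
by move/forallP: (dG x) => /(_ y) /implyP /(_ xy).
Qed.

Lemma rank_dag G (g : T -> nat) : (forall x y, erel G x y -> g x < g y) -> dag G.
Proof.
move=> Hg; apply/forallP => u; apply/forallP => v; apply/implyP => uv.
apply/negP => /connectP[p]; have := Hg _ _ uv => {uv}.
elim: p v => [|z p IH] v guv /=; first by move=> _ E; rewrite E ltnn in guv.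
by case/andP=> vz pz; apply: IH pz; apply: ltn_trans guv (Hg _ _ vz).
Qed.

Lemma dag_asym G x y : dag G -> erel G x y -> ~~ erel G y x.
Proof. by case/dag_rank=> g Hg xy; apply/negP => /Hg; have := Hg _ _ xy; lia. Qed.

Lemma dag_cycle3 G x y z : dag G -> erel G x y -> erel G y z -> ~~ erel G z x.
Proof.
case/dag_rank=> g Hg xy yz; apply/negP => /Hg.
by have := Hg _ _ xy; have := Hg _ _ yz; lia.
Qed.

Lemma dag_adjxx G x : dag G -> adj G x x = false.
Proof.
case/dag_rank=> g Hg; rewrite /adj orbb; apply/negP => /Hg; by rewrite ltnn.
Qed.

Lemma adjC G x y : adj G x y = adj G y x.
Proof. by rewrite /adj orbC. Qed.

Lemma vstructC G x y z : vstruct G x y z = vstruct G z y x.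
Proof. by rewrite /vstruct adjC eq_sym andbCA. Qed.

Lemma undC O x y : und O x y = und O y x.
Proof. by rewrite /und andbC. Qed.

Lemma adjpC O x y : adjp O x y = adjp O y x.
Proof. by rewrite /adjp orbC. Qed.

Lemma adjp_cases O x y : adjp O x y -> [\/ dir O x y, dir O y x | und O x y].
Proof.
rewrite /adjp /dir /und; case xy: (O x y); case yx: (O y x) => //= _; by [constructor 3|constructor 1|constructor 2].
Qed.

Lemma dir_undF O x y : dir O x y -> und O x y -> False.
Proof. by move=> /andP[_ /negPf xy] /andP[_]; rewrite xy. Qed.

Lemma dir_undF' O x y : dir O x y -> und O y x -> False.
Proof. by rewrite undC; apply: dir_undF. Qed.

Lemma und_adjp O x y : und O x y -> adjp O x y.
Proof. by rewrite /und /adjp => /andP[->]. Qed.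

(* Every Meek step on O preserves this, so no arc of D is ever dropped by the closure. *)
Definition compat D O :=
  [/\ forall x y, erel D x y -> O x y,
      forall x y, adjp O x y = adj D x y &
      forall x y z, vstruct D x y z -> ~~ O y x].

Section Compat.
Variables (D : {set T * T}) (O : rel T).
Hypotheses (dD : dag D) (cDO : compat D O).

Lemma compat_dir x y : dir O x y -> erel D x y.
Proof.
case: cDO => sub adjE _ /andP[Oxy nOyx].
have: adj D x y by rewrite -adjE /adjp Oxy.
by case/orP=> // /sub; rewrite (negPf nOyx).
Qed.

(** Arcs of v-structures of [D] are already directed in [O], so an arc that is still undirected
    forms none with another parent of its head. *)
Lemma compat_moral x y z : und O x z -> erel D x z -> erel D y z -> x != y -> adjp O x y.
Proof.
case: cDO => _ adjE vs /andP[_ Ozx] xz yz xy; apply/negPn/negP.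
rewrite adjE => nxy; have/vs: vstruct D x z y by rewrite /vstruct xz yz xy.
by rewrite Ozx.
Qed.

Lemma compat_und x y : und O x y -> erel D x y || erel D y x.
Proof. by case: cDO => _ adjE _ /andP[Oxy _]; rewrite -/(adj D x y) -adjE /adjp Oxy. Qed.

Lemma compat_und_neq x y : und O x y -> x != y.
Proof. by move/compat_und=> xy; apply/eqP => E; move: xy; rewrite E -/(adj D y y) dag_adjxx. Qed.

(** Suppose [D] had [b -> a] instead. R2 then closes a directed cycle. In R3 and R4 acyclicity makes
    [c] and [d] parents of [a]. In R1, R3 and R4 two nonadjacent vertices end up as parents of [a],
    at least one along an undirected edge, against [compat_moral]. *)
Lemma meek_app_sound a b : meek_app O a b -> erel D a b.
Proof.
case/andP=> ab rules; case/orP: (compat_und ab) => // ba; exfalso.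
have ba' : und O b a by rewrite undC.
have neq x y z : dir O x y -> und O z y -> x != z.
  by move=> /andP[_ /negPf xy] /andP[_ yz]; apply/eqP => E; rewrite E yz in xy.
case/or4P: rules.
- case/existsP=> c /andP[ca]; apply/negP/negPn; rewrite adjpC.
  apply: (compat_moral ba' ba (compat_dir ca)).
  by rewrite eq_sym; apply: neq ca ba'.
- case/existsP=> c /andP[/compat_dir ac /compat_dir cb].
  by move: (dag_cycle3 dD ac cb); rewrite ba.
- case/existsP=> c /existsP[d /and5P[da ac /compat_dir db /compat_dir cb /andP[cd]]].
  apply/negP/negPn.
  have ca : erel D c a.
    case/orP: (compat_und ac) => // ac'; by move: (dag_cycle3 dD ac' cb); rewrite ba.
  have da' : erel D d a.
    case/orP: (compat_und da) => // ad'; by move: (dag_cycle3 dD ad' db); rewrite ba.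
  by apply: compat_moral ca da' cd; rewrite undC.
- case/existsP=> c /existsP[d /and5P[da ac /compat_dir dc /compat_dir cb /andP[bd]]].
  apply/negP/negPn.
  have ca : erel D c a.
    case/orP: (compat_und ac) => // ac'; by move: (dag_cycle3 dD ac' cb); rewrite ba.
  have da' : erel D d a.
    case/orP: (compat_und da) => // ad'; by move: (dag_cycle3 dD ad' dc); rewrite ca.
  exact: compat_moral ba' ba da' bd.
Qed.

End Compat.

(** * Invariants and termination of the Meek closure *)

Lemma meek_stepP O :
  (exists a b, meek_app O a b /\
     meek_step O = fun x y => ~~ ((x == b) && (y == a)) && O x y) \/
  ((forall a b, ~~ meek_app O a b) /\ meek_step O = O).
Proof.
rewrite /meek_step; case: pickP => [[a b] /= ab|no]; first by left; exists a, b.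
by right; split => // a b; apply/negbT; apply: (no (a, b)).
Qed.

Lemma meek_step_sub O x y : meek_step O x y -> O x y.
Proof. by case: (meek_stepP O) => [[a [b [_ ->]]] /andP[]|[_ ->]]. Qed.

Lemma meek_step_dir O x y : dir O x y -> dir (meek_step O) x y.
Proof.
case: (meek_stepP O) => [[a [b [ab ->]]]|[_ ->]] //.
rewrite /dir => /andP[xy nyx]; rewrite xy (negPf nyx) !andbF !andbT /=.
apply/negP => /andP[/eqP xb /eqP ya]; case/andP: ab => /andP[ab _] _.
by rewrite xb ya ab in nyx.
Qed.

Lemma meek_step_compat D O : dag D -> compat D O -> compat D (meek_step O).
Proof.
move=> dD cDO; case: (meek_stepP O) => [[a [b [ab ->]]]|[_ ->]] //.
have Dab := meek_app_sound dD cDO ab; case: cDO => sub adjE vs; split.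
- move=> x y xy; rewrite (sub _ _ xy) andbT; apply/negP => /andP[/eqP xb /eqP ya].
  by move: (dag_asym dD Dab); rewrite -xb -ya xy.
- move=> x y; rewrite -adjE /adjp; case/andP: ab => /andP[ab ba] _.
  have nab : (a == b) = false.
    by apply/eqP => E; move: (dag_asym dD Dab); rewrite E -{1}E Dab.
  case p: ((x == b) && (y == a)); last case q: ((y == b) && (x == a)) => //=.
    by case/andP: p => /eqP-> /eqP->; rewrite nab /= ab ba orbT.
  by case/andP: q => /eqP-> /eqP->; rewrite ab ba.
- by move=> x y z /vs; rewrite negb_and orbC => ->.
Qed.

Definition meek_iter k O := iter k (@meek_step T) O.

Lemma meek_iter_compat k D O : dag D -> compat D O -> compat D (meek_iter k O).
Proof. by move=> dD cDO; elim: k => //= k; apply: meek_step_compat. Qed.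

Lemma meek_iter_dir k j O x y : dir (meek_iter k O) x y -> dir (meek_iter (j + k) O) x y.
Proof. by move=> xy; elim: j => // j IH; apply: meek_step_dir. Qed.

(** Each effective step removes a pair from a relation with at most [#|T| ^ 2] pairs, so the
    iteration either reaches a closed relation or exhausts all pairs. *)
Lemma meek_closed O a b : ~~ meek_app (meek_closure O) a b.
Proof.
pose m O' := #|[set p : T * T | O' p.1 p.2]|.
have step O' : (forall a b, ~~ meek_app O' a b) /\ meek_step O' = O' \/ m (meek_step O') < m O'.
  case: (meek_stepP O') => [[c [d [cd E]]]|]; last by left.
  right; apply: proper_card; apply/properP; split.
    by apply/subsetP => p; rewrite !inE; apply: meek_step_sub.
  case/andP: cd => /andP[_ dc] _.
  by exists (d, c); rewrite !inE // E /= !eqxx.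
have loop k : (forall a b, ~~ meek_app (meek_iter k O) a b) \/ m (meek_iter k O) + k <= #|T| ^ 2.
  elim: k => [|k [IH|IH]].
  - right; rewrite addn0 (leq_trans (max_card _)) //.
    by rewrite card_prod expnS expn1.
  - left => c d /=; case: (step (meek_iter k O)) => [[H E]|H]; first by rewrite E.
    case: (meek_stepP (meek_iter k O)) => [[x [y [xy _]]]|[H' ->//]].
    by move: (IH x y); rewrite xy.
  - case: (step (meek_iter k O)) => [[H E]|H]; [left=> c d /=|right => /=].
      by rewrite E.
    by rewrite addnS (leq_trans _ IH) // ltn_add2r.
case: (loop (#|T| ^ 2)) => [H|]; first exact: H.
(* Here no pair is left, hence no undirected edge on which a rule could act. *)
rewrite -[X in _ <= X]add0n leq_add2r leqn0 cards_eq0 => /eqP E.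
apply/negP => /andP[/andP[ab _] _].
by move/setP: E => /(_ (a, b)); rewrite !inE /= => /negP; apply; exact: ab.
Qed.

Lemma init_oriented_vs G I x y z : vstruct G x y z -> init_oriented G I x y.
Proof. by move=> v; rewrite /init_oriented; apply/or3P; constructor 3; apply/existsP; exists z. Qed.

(** Agreement is asked only on initially oriented edges, so that [D] may be [G] itself or [G] with a
    covered edge reversed. *)
Lemma init_pdag_compat G D I : dag G -> mec G D ->
    (forall x y, erel G x y -> init_oriented G I x y -> erel D x y) ->
  compat D (init_pdag G I).
Proof.
move=> dG /and3P[dD /forallP adjE /forallP vsE] agree.
have adjGD x y : adj G x y = adj D x y by apply/eqP; move/forallP: (adjE x); apply.
have vsGD x y z : vstruct G x y z = vstruct D x y z.
  by apply/eqP; move/forallP: (vsE x) => /(_ y)/forallP.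
split.
- move=> x y xy; have: adj G x y by rewrite adjGD /adj xy.
  rewrite /init_pdag => /orP[->//|yx]; rewrite yx /=; apply/orP; right.
  apply/negP => /(agree _ _ yx) yx'; by move: (dag_asym dD xy); rewrite yx'.
- move=> x y; rewrite -adjGD /adjp /init_pdag /adj.
  by case: (erel G x y); case: (erel G y x) => //=; rewrite ?orbT.
- move=> x y z; rewrite -vsGD => v; rewrite /init_pdag.
  have xy : erel G x y by case/andP: v.
  by rewrite (init_oriented_vs I v) andbF orbF dag_asym.
Qed.

Lemma mec_refl G : dag G -> mec G G.
Proof. by move=> dG; apply/and3P; split=> //; apply/forallP=> x; apply/forallP=> y //; apply/forallP=> z. Qed.

Lemma essential_compat G I : dag G -> compat G (essential G I).
Proof.
move=> dG; apply: meek_iter_compat => //; apply: init_pdag_compat => //; exact: mec_refl.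
Qed.

(** * Covered edges *)

Definition covered G u v :=
  erel G u v /\ forall z, z != u -> erel G z v = erel G z u.

(** If [I] missed both ends, the reversed graph would be compatible with the closure too, so the
    essential graph would contain [v -> u], which [G] lacks. *)
Lemma covered_edge_hit G I u v : dag G -> covered G u v -> verifying G I -> (u \in I) || (v \in I).
Proof.
move=> dG [uv par] ver; apply/negPn/negP; rewrite negb_or => /andP[uI vI].
have nuv : u != v by apply/eqP => E; move: (dag_adjxx v dG); rewrite /adj -{1}E uv.
have nvu := dag_asym dG uv.
(* D reverses u -> v; it is ranked by moving v to just before u. *)
pose D := (v, u) |: (G :\ (u, v)).
have DE x y : erel D x y = if (x == v) && (y == u) then true else
     if (x == u) && (y == v) then false else erel G x y.
  by rewrite /erel /D !inE !xpair_eqE; case: ((x == v) && _) => //; case: ((x == u) && _).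
have dD : dag D.
  case/dag_rank: (dG) => g Hg.
  apply: (@rank_dag D (fun x => if x == v then (g u).*2 else (g x).*2.+1)) => x y.
  rewrite DE; case: (x =P v) => [->|xv] /=.
    case: (y =P u) => [->|yu]; first by rewrite (negPf nuv) ltnS.
    rewrite eq_sym (negPf nuv) /= => vy; have := Hg _ _ vy; have := Hg _ _ uv.
    case: eqP => [->|_]; lia.
  case: (x =P u) => [->|xu] /=.
    case: (y =P v) => //= _; move/Hg; lia.
  case: (y =P v) => [->|_]; last by move/Hg; lia.
  (* A parent of [v] other than [u] is also a parent of [u], so it ranks below the new place of
     [v]. *)
  by rewrite par; [move/Hg; lia|apply/eqP].
have adjE x y : adj G x y = adj D x y.
  rewrite /adj !DE; case: (x =P v) => [->|_]; case: (y =P v) => [->|_]; rewrite ?eqxx ?(eq_sym v) ?(negPf nuv) /=; rewrite ?andbF //=.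
  - by case: (y =P u) => [->|] //=; rewrite uv ?orbT.
  - by case: (x =P u) => [->|] //=; rewrite uv ?orbT.
(* Only colliders at [u] or [v] are at stake. There the other end of the reversed edge is adjacent
   to every remaining parent, since the edge is covered, so it takes part in no v-structure. *)
have vsim x y z : vstruct G x y z = vstruct D x y z.
  rewrite /vstruct -adjE !DE.
  case: (y =P u) => [->|yu]; rewrite ?(negPf nuv) ?andbF ?andbT.
    case: (x =P v) => [->|xv]; case: (z =P v) => [->|zv] //=; rewrite ?(negPf nvu) //=.
    - by rewrite eqxx.
    - case zu: (erel G z u) => //=.
      have zu' : z != u by apply/eqP => E; move: (dag_adjxx u dG); rewrite /adj -{1}E zu.
      by rewrite /adj (par _ zu') zu orbT andbF.
    - case xu: (erel G x u) => //=.
      have xu' : x != u by apply/eqP => E; move: (dag_adjxx u dG); rewrite /adj -{1}E xu.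
      by rewrite /adj (par _ xu') xu andbF.
  case: (y =P v) => [->|yv]; rewrite ?andbF ?andbT //=.
  case: (x =P u) => [->|xu]; case: (z =P u) => [->|zu] //=; rewrite ?eqxx ?andbF //=.
  - by case zv: (erel G z v) => //=; rewrite ?andbF // /adj -(par z) ?zv ?orbT ?andbF //; apply/eqP.
  - by case xv: (erel G x v) => //=; rewrite ?andbF // /adj -(par x) ?xv ?orbT ?andbF //; apply/eqP.
have mGD : mec G D.
  apply/and3P; split => //; apply/forallP=> x; apply/forallP=> y; first by rewrite adjE.
  by apply/forallP=> z; rewrite vsim.
have cD : compat D (essential G I).
  apply: meek_iter_compat => //; apply: init_pdag_compat => // x y xy.
  rewrite DE xy; do 2![case: ifP => //] => /andP[/eqP-> /eqP->] _.
  rewrite /init_oriented (negPf uI) (negPf vI) /= => /existsP[z /and4P[_ zv uz]].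
  by rewrite /adj -(par z) ?zv ?orbT // eq_sym.
case: cD => /(_ v u) sub _ _; move/forallP: ver => /(_ v)/forallP/(_ u)/eqP.
by rewrite sub ?DE ?eqxx // (negPf nvu).
Qed.

(** * Essential graphs are chain graphs *)

Section ChainGraph.
Variables (G : {set T * T}) (I : {set T}).
Hypothesis dG : dag G.
Let O := essential G I.
Let cO : compat G O. Proof. exact: essential_compat. Qed.

Lemma essential_R1 c a b : dir O c a -> und O a b -> adjp O c b.
Proof.
move=> ca ab; apply/negPn/negP => cb; have := @meek_closed (init_pdag G I) a b.
rewrite -/(essential G I) -/O /meek_app ab /= => /negP; apply.
by apply/or4P; constructor 1; apply/existsP; exists c; rewrite ca.
Qed.

Lemma essential_R2 a c b : dir O a c -> dir O c b -> adjp O a b -> dir O a b.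
Proof.
move=> ac cb /adjp_cases[//|/(compat_dir cO) ba|ab].
  by move: (dag_cycle3 dG (compat_dir cO ac) (compat_dir cO cb)); rewrite ba.
have := @meek_closed (init_pdag G I) a b.
rewrite -/(essential G I) -/O /meek_app ab /= => /negP[].
by apply/or4P; constructor 2; apply/existsP; exists c; rewrite ac.
Qed.

Lemma essential_R3 a b c d : und O d a -> und O a c -> dir O d b -> dir O c b ->
  c != d -> ~~ adjp O c d -> ~~ und O a b.
Proof.
move=> da ac db cb cd ncd; apply/negP => ab; have := @meek_closed (init_pdag G I) a b.
rewrite -/(essential G I) -/O /meek_app ab /= => /negP[].
by apply/or4P; constructor 3; apply/existsP; exists c; apply/existsP; exists d; apply/and5P; split=> //; rewrite cd.
Qed.

Lemma essential_R4 a b c d : und O d a -> und O a c -> dir O d c -> dir O c b ->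
  b != d -> ~~ adjp O b d -> ~~ und O a b.
Proof.
move=> da ac db cb cd ncd; apply/negP => ab; have := @meek_closed (init_pdag G I) a b.
rewrite -/(essential G I) -/O /meek_app ab /= => /negP[].
by apply/or4P; constructor 4; apply/existsP; exists c; apply/existsP; exists d; apply/and5P; split=> //; rewrite cd.
Qed.

(** R1 makes [a] and [c] adjacent, and [c -> a] would direct [c - b] by R2. The chain property can
    thus fail only on a triangle with two undirected edges. *)
Lemma essential_triangle a b c : dir O a b -> und O b c -> ~~ dir O a c -> und O a c.
Proof.
move=> ab bc nac; case: (adjp_cases (essential_R1 ab bc)) => // [ac|ca]; first by rewrite ac in nac.
case: (@dir_undF' O c b) => //; apply: essential_R2 ca ab _.
by rewrite /adjp; case/andP: bc => _ ->.
Qed.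

(** The chain property is proved by induction on the stage at which an edge becomes directed;
    directions at a stage persist in [O], whereas undirected edges may still be oriented later. *)
Let Ok k := meek_iter k (init_pdag G I).

Let cOk k : compat G (Ok k).
Proof. by apply: meek_iter_compat => //; apply: init_pdag_compat => //; apply: mec_refl. Qed.

Let Ok_dir k x y : k <= #|T| ^ 2 -> dir (Ok k) x y -> dir O x y.
Proof. by move=> le /(meek_iter_dir (#|T| ^ 2 - k)); rewrite subnK. Qed.

Let Ok_adj k x y : adjp (Ok k) x y = adjp O x y.
Proof. by case: cO (cOk k) => _ -> _ [_ -> _]. Qed.

Let Ok_und_adj k x y : und (Ok k) x y -> adjp O x y.
Proof. by move/und_adjp; rewrite Ok_adj. Qed.

Let init_dir x y z : vstruct G x y z -> dir O x y.
Proof.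
move=> v; apply: (@Ok_dir 0) => //.
have xy : erel G x y by case/andP: v.
rewrite /dir /= /init_pdag xy (init_oriented_vs I v) /= ?andbF ?orbF.
exact: dag_asym.
Qed.

Lemma init_dirP a b : dir (init_pdag G I) a b ->
  [\/ a \in I, b \in I | exists y, vstruct G a b y].
Proof.
rewrite /dir /init_pdag; case ab: (erel G a b); last by case: (erel G b a) => //=; rewrite andbF.
rewrite (negPf (dag_asym dG ab)) /= negbK => /or3P[]; [by constructor 1|by constructor 2|].
by case/existsP=> y v; constructor 3; exists y.
Qed.

Lemma essential_I_und x y : x \in I -> ~~ und O x y.
Proof.
move=> xI; apply/negP => xy; wlog: x y xI xy / erel G x y || erel G y x && (y \notin I).
  move=> W; case/orP: (compat_und cO xy) => [e|e]; first by apply: (W x y) => //; rewrite e.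
  case yI: (y \in I); first by apply: (W y x) => //; rewrite 1?undC // e.
  by apply: (W x y) => //; rewrite e yI orbT.
case/orP => [e|/andP[e _]].
  apply: (@dir_undF O x y) => //; apply: (@Ok_dir 0) => //.
  by rewrite /dir /= /init_pdag e (negPf (dag_asym dG e)) /= negbK /init_oriented xI.
apply: (@dir_undF' O y x) => //; apply: (@Ok_dir 0) => //.
by rewrite /dir /= /init_pdag e (negPf (dag_asym dG e)) /= negbK /init_oriented xI orbT.
Qed.

Let und_dir_cases a b c : dir O a b -> und O b c -> dir O a c \/ und O a c.
Proof.
move=> ab bc; case ac: (dir O a c); first by left.
by right; apply: essential_triangle ab bc _; rewrite ac.
Qed.

(* Meek's lemma: a violating triangle a -> b - c - a would force an earlier one,
   by inspection of the rule that oriented a -> b. *)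
Lemma meek_iter_chain k a b c : k <= #|T| ^ 2 ->
  dir (Ok k) a b -> und O b c -> dir O a c.
Proof.
elim: k a b c => [|k IH] a b c lek ab bc.
  have abO := Ok_dir lek ab.
  apply/negPn/negP => /(essential_triangle abO bc) ac.
  case: (init_dirP ab) => [aI|bI|[y v]].
  - by move: (essential_I_und c aI); rewrite ac.
  - by move: (essential_I_und c bI); rewrite bc.
  (* For a v-structure [a -> b <- y]: if [y -> c], R1 at [c - a] makes [y] and [a] adjacent; if
     [y - c], R3 orients [c -> b]. *)
  have yb : dir O y b by apply: (@init_dir _ _ a); rewrite vstructC.
  have nay : ~~ adjp O a y by case: cO => _ -> _; case/and4P: v.
  case: (und_dir_cases yb bc) => [yc|yc].
    by move/negP: nay; apply; rewrite adjpC; apply: (essential_R1 yc); rewrite undC.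
  have anb : a != y by case/and4P: v.
  have: ~~ und O c b by apply: (@essential_R3 c b a y) => //; rewrite undC.
  by rewrite undC bc.
have abO := Ok_dir lek ab.
have leqk : k <= #|T| ^ 2 by apply: ltnW.
apply/negPn/negP => nac; have ac := essential_triangle abO bc nac.
have ca : und O c a by rewrite undC.
have cb : und O c b by rewrite undC.
have {}IH x y : dir (Ok k) x y -> forall z, und O y z -> dir O x z.
  by move=> xy z; apply: IH.
have OD x y := Ok_dir leqk (x := x) (y := y).
case old: (dir (Ok k) a b); first by rewrite (IH _ _ old) in nac.
case: (meek_stepP (Ok k)) => [[a' [b' [app E]]]|[_ E]]; last first.
  by move: ab; rewrite /Ok /= E -/(Ok k) old.
(* The edge became directed in this very step, so it is the one to which a rule was applied. *)
have [Ea Eb] : a = a' /\ b = b'.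
  move: ab old; rewrite /Ok /= E -/(Ok k) /dir.
  case: (Ok k a b); rewrite ?andbF //= andbT => /andP[_].
  by case: (Ok k b a) => //=; rewrite andbT negbK => /andP[/eqP-> /eqP->].
case/andP: app => _; rewrite -Ea -Eb => /or4P[].
(* R1: induction gives [d -> c], and then [c - b] forces [d] and [b] to be adjacent. *)
- case/existsP=> d /andP[da]; rewrite Ok_adj => /negP[].
  apply: essential_R1 (cb) => //.
  exact: IH da _ ac.
(* R2: induction gives [d -> c], so R2 already orients [a -> c]. *)
- case/existsP=> d /andP[ad db].
  by move/negP: nac; apply; apply: (@essential_R2 a d c); [exact: OD|exact: IH db _ bc|exact: und_adjp].
(* R3: the edges from [a] to [d] and [e] may have been directed later. An arc out of [a] yields
   [a -> c] by R2; two arcs into [a] form a v-structure, directed from the start; one arc into [a]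
   and one undirected edge contradict R1; two undirected edges let R3 orient [a -> c]. *)
- case/existsP=> e /existsP[d /and5P[da ae db eb /andP[ed nde]]].
  have dc := IH _ _ db _ bc; have ec := IH _ _ eb _ bc.
  rewrite Ok_adj in nde.
  have notdir x : dir O a x -> dir O x c -> False.
    by move=> ax xc; move/negP: nac; apply; apply: essential_R2 ax xc (und_adjp ac).
  have tovs x y : und (Ok k) x a -> dir O x a -> dir O y a -> x != y -> ~~ adjp O x y -> False.
    move=> xa /(compat_dir cO) dxa /(compat_dir cO) dya xy nxy.
    have: vstruct G x a y by rewrite /vstruct dxa dya xy; case: cO nxy => _ -> _.
    by case: (cOk k) => _ _ H /H; case/andP: xa => _ ->.
  case: (adjp_cases (Ok_und_adj da)) => [da'|ad'|da'].
  + case: (adjp_cases (Ok_und_adj ae)) => [ae'|ea'|ae'].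
    * exact: notdir ae' ec.
    * by apply: (tovs d e) => //; rewrite 1?eq_sym // adjpC.
    * by move/negP: nde; apply; rewrite adjpC; apply: essential_R1 da' ae'.
  + exact: notdir ad' dc.
  + case: (adjp_cases (Ok_und_adj ae)) => [ae'|ea'|ae'].
    * exact: notdir ae' ec.
    * by move/negP: nde; apply; apply: (essential_R1 ea'); rewrite undC.
    * by have := essential_R3 da' ae' dc ec ed nde; rewrite ac.
(* R4: [d] and [c] turn out nonadjacent. Directing either edge at [a] then contradicts R1 or R2, and
   if both stay undirected R4 applies with [c] in the place of [b]. *)
- case/existsP=> e /existsP[d /and5P[da ae de eb /andP[bd nbd]]].
  rewrite Ok_adj in nbd.
  have de' := OD _ _ de; have ec := IH _ _ eb _ bc.
  have notdir x : dir O a x -> dir O x c -> False.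
    by move=> ax xc; move/negP: nac; apply; apply: essential_R2 ax xc (und_adjp ac).
  have ndc : ~~ adjp O d c.
    apply/negP => dc; have dc' := essential_R2 de' ec dc.
    by move/negP: nbd; apply; rewrite adjpC; apply: essential_R1 dc' cb.
  have notae : ~~ dir O a e by apply/negP => ae'; exact: notdir ae' ec.
  case: (adjp_cases (Ok_und_adj da)) => [da'|ad'|da'].
  + by move/negP: ndc; apply; apply: essential_R1 da' ac.
  + by move/negP: notae; apply; apply: essential_R2 ad' de' (Ok_und_adj ae).
  + case: (adjp_cases (Ok_und_adj ae)) => [ae'|ea'|ae'].
    * by rewrite ae' in notae.
    * by apply: (@dir_undF O d a) => //; apply: essential_R2 de' ea' (und_adjp da').
    * have cd : c != d.
        apply/eqP => E'; move: (compat_dir cO de'); rewrite -E' => ce.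
        by move: (dag_asym dG ce); rewrite (compat_dir cO ec).
      have: ~~ und O a c by apply: (essential_R4 da' ae' de' ec cd); rewrite adjpC.
      by rewrite ac.
Qed.

Lemma essential_chain a b c : dir O a b -> und O b c -> dir O a c.
Proof. exact: meek_iter_chain. Qed.

Lemma essential_chain_connect a b c : dir O a b -> connect (und O) b c -> dir O a c.
Proof.
move=> ab /connectP[p pth ->] {c}; elim: p b ab pth => //= x p IH b ab /andP[bx].
by apply: IH; apply: essential_chain ab bx.
Qed.

Lemma dir_not_connect a b : dir O a b -> ~~ connect (und O) a b.
Proof.
move=> ab; apply/negP => conn.
have: dir O a a.
  apply: essential_chain_connect ab _.
  by rewrite (sym_connect_sym (@undC O)).
by case/andP => ->.
Qed.

End ChainGraph.
End Dags.

(** * Perfect elimination orders with a prescribed start *)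

Section Chordal.
Variables (T : finType) (U : rel T).
Hypotheses (symU : symmetric U) (irrU : irreflexive U).
Implicit Types (A C H S : {set T}) (f : T -> nat).

Definition simplicial S x :=
  forall y z, y \in S -> z \in S -> U y x -> U z x -> y != z -> U y z.

(** Chordality in its elimination form instead of through chordless cycles, which makes it
    hereditary at once. *)
Definition chordal H :=
  forall S, S \subset H -> S != set0 -> exists2 x, x \in S & simplicial S x.

Lemma chordalS H S : S \subset H -> chordal H -> chordal S.
Proof. by move=> SH cH S' S'S; apply: cH; apply: subset_trans S'S SH. Qed.

Lemma cliqueP S C : reflect (C \subset S /\ {in C &, forall x y, x != y -> U x y}) (clique U S C).
Proof.
apply: (iffP andP) => [[CS /forall_inP H]|[CS H]]; split => //.
  by move=> x y xC yC; move/forall_inP: (H x xC) => /(_ y yC)/implyP.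
by apply/forall_inP => x xC; apply/forall_inP => y yC; apply/implyP; apply: H.
Qed.

(** A variant of Dirac's theorem. If the simplicial vertex [x] found lies in [C], then [C] is
    contained in [x] and its clique [K] of neighbours. Either [S] is itself a clique, or induction
    on [S :\ x] and [K] gives a vertex not adjacent to [x], which stays simplicial in [S]. *)
Lemma chordal_simplicial_notin S C : chordal S -> clique U S C -> C != S ->
  exists2 x, x \in S :\: C & simplicial S x.
Proof.
have [n] := ubnP #|S|; elim: n S C => // n IH S C ltn cS cC nCS.
have [CS clC] := cliqueP _ _ cC.
have [x0 x0S x0C]: exists2 x, x \in S & x \notin C.
  by apply/subsetPn; apply: contra nCS => SC; rewrite eqEsubset CS.
have Sn0 : S != set0 by apply/set0Pn; exists x0.
have [x xS sx] := cS S (subxx _) Sn0.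
case xC: (x \in C); last by exists x; rewrite ?inE ?xC.
pose K := [set y in S | U y x].
have cK : clique U (S :\ x) K.
  apply/cliqueP; split.
    apply/subsetP => y; rewrite !inE => /andP[-> yx]; rewrite andbT.
    by apply/eqP => E; rewrite E irrU in yx.
  by move=> y z; rewrite !inE => /andP[yS yx] /andP[zS zx]; apply: sx.
have CK y : y \in C -> y != x -> y \in K.
  by move=> yC yx; rewrite inE (subsetP CS) //= clC.
case: (K =P S :\ x) => [EK|/eqP nK].
  exists x0; first by rewrite inE x0C.
  have all y z : y \in S -> z \in S -> y != z -> U y z.
    move=> yS zS yz; case: (y =P x) => [E|/eqP yx].
      have: z \in K by rewrite EK !inE zS -E eq_sym yz.
      by rewrite inE E symU => /andP[].
    have yK : y \in K by rewrite EK !inE yx.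
    case: (z =P x) => [E|/eqP zx]; first by move: yK; rewrite inE E => /andP[].
    have zK : z \in K by rewrite EK !inE zx.
    by move: yK zK; rewrite !inE => /andP[_ yK] /andP[_ zK]; apply: sx.
  by move=> y z yS zS _ _; apply: all.
have [||y] := IH (S :\ x) K _ _ cK nK.
- by rewrite (cardsD1 x S) xS in ltn.
- by apply: chordalS cS; rewrite subsetDl.
rewrite !inE => /and3P[nyK yx yS] sy; rewrite yS /= in nyK.
exists y; first by rewrite inE yS andbT; apply/negP => /CK/(_ yx); rewrite inE yS (negPf nyK).
move=> a b aS bS ay byy; apply: sy => //; rewrite !inE ?aS ?bS andbT.
  by apply/eqP => E; rewrite E symU (negPf nyK) in ay.
by apply/eqP => E; rewrite E symU (negPf nyK) in byy.
Qed.

(* Orientations of U on H are encoded by a ranking f: u -> v iff f u < f v. *)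
Definition moral_order H f :=
  {in H &, injective f} /\
  {in H & &, forall x y z, U x z -> U y z -> f x < f z -> f y < f z -> x != y -> U x y}.

(** Vertices outside [A] are peeled off as simplicial ones and ranked last in turn; the earlier
    neighbours of such a vertex are then pairwise adjacent. *)
Lemma moral_order_extend H A f0 : A \subset H -> moral_order A f0 ->
    (forall S, A \proper S -> S \subset H -> exists2 x, x \in S :\: A & simplicial S x) ->
  exists f, [/\ moral_order H f, {in A, f =1 f0} &
              forall a x, a \in A -> x \in H -> x \notin A -> f a < f x].
Proof.
move=> AH m0 simp.
suff: forall S, A \subset S -> S \subset H -> exists f, [/\ moral_order S f, {in A, f =1 f0} &
              forall a x, a \in A -> x \in S -> x \notin A -> f a < f x] by apply.
move=> S; have [n] := ubnP #|S|; elim: n S => // n IH S ltS AS SH.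
case: (A =P S) => [<-|/eqP nAS].
  by exists f0; split => // a x _ ->.
have [|x] := simp S _ SH; first by rewrite properEneq nAS.
rewrite inE => /andP[xA xS] sx.
have [|||f [[injf mf] f0E fA]] := IH (S :\ x).
- by rewrite (cardsD1 x S) xS in ltS.
- by rewrite subsetD1 AS.
- by rewrite subDset (subset_trans SH) // subsetUr.
pose M := (\max_(y : T) f y).+1.
have fM y : f y < M by rewrite ltnS leq_bigmax.
pose f' y := if y == x then M else f y.
exists f'; split.
- split.
    move=> y z yS zS; rewrite /f'; case: (y =P x) => [->|/eqP yx]; case: (z =P x) => [->|/eqP zx] //.
    + by move=> E; have := fM z; rewrite E ltnn.
    + by move=> E; have := fM y; rewrite E ltnn.
    + by apply: injf; rewrite !inE ?yx ?zx.
  move=> y z t yS zS tS; rewrite /f'; case: (t =P x) => [->|/eqP tx].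
    by move=> yx zx _ _; apply: sx.
  case: (y =P x) => [->|/eqP yx]; first by move=> _ _; rewrite ltnNge (ltnW (fM t)).
  case: (z =P x) => [->|/eqP zx]; first by move=> _ _ _; rewrite ltnNge (ltnW (fM t)).
  by apply: mf; rewrite !inE ?yx ?zx ?tx.
- move=> a aA; rewrite /f'; case: (a =P x) => [E|_]; last exact: f0E.
  by rewrite -E aA in xA.
- move=> a y aA yS yA; rewrite /f'; case: (a =P x) => [E|/eqP ax].
    by rewrite -E aA in xA.
  case: (y =P x) => [E|/eqP yx]; first exact: fM.
  by apply: fA => //; rewrite !inE yx.
Qed.

Definition covered_in H f u v :=
  [/\ u \in H, v \in H, U u v, f u < f v &
      forall z, z \in H -> z != u -> (U z v && (f z < f v)) = (U z u && (f z < f u))].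

Definition covers H f (I : {set T}) :=
  forall u v, covered_in H f u v -> (u \in I) || (v \in I).

(** Vertices outside [A] come later than both ends, so they add no parent to either. *)
Lemma covered_in_extend H A f0 f u v : A \subset H -> {in A, f =1 f0} ->
    (forall a x, a \in A -> x \in H -> x \notin A -> f a < f x) ->
  covered_in A f0 u v -> covered_in H f u v.
Proof.
move=> AH fE fA [uA vA uv luv par]; split => //; rewrite ?(subsetP AH) ?fE //.
move=> z zH zu; case zA: (z \in A); first by rewrite fE // par.
have := fA u z uA zH; have := fA v z vA zH; rewrite zA (fE u uA) (fE v vA) => /(_ isT) h1 /(_ isT) h2.
by rewrite !(ltnNge (f z)) (ltnW h1) (ltnW h2) !andbF.
Qed.

End Chordal.

(** * Covers of weighted cliques *)

Local Open Scope ring_scope.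

Section Weights.
Variables (T : finType) (U : rel T).
Hypotheses (symU : symmetric U) (irrU : irreflexive U).
Variables (R : realFieldType) (w : T -> R).
Hypothesis w_ge0 : forall v, 0 <= w v.
Implicit Types (A C H S I : {set T}) (f : T -> nat).

Lemma wset_ge0 C : 0 <= wset w C.
Proof. by apply: sumr_ge0. Qed.

Lemma wsetS A C : A \subset C -> wset w A <= wset w C.
Proof.
move=> sAC; rewrite /wset [leRHS](big_setID A) /= (setIidPr sAC) lerDl; apply: sumr_ge0 => //.
Qed.

Lemma weight_order : exists f : T -> nat, injective f /\ forall x y, (f x < f y)%N -> w y <= w x.
Proof.
pose r := fun x y : T => w y <= w x.
have totr : total r by move=> x y; apply: le_total.
have trr : transitive r by move=> y x z yx zy; apply: le_trans zy yx.
pose L := sort r (enum T).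
have inL x : x \in L by rewrite mem_sort mem_enum.
exists (index^~ L); split; first by move=> x y /(congr1 (nth x L)); rewrite !nth_index.
move=> x y lt; apply: (sorted_ltn_index trr (sort_sorted totr _)) lt; exact: inL.
Qed.

(* Summing over the consecutive pairs of C counts every vertex at most twice, and the
   first vertex a only once; each pair contributes the weight of its lighter end. *)
Lemma path_cover_bound f C I a : injective f -> (forall x y, (f x < f y)%N -> w y <= w x) ->
    a \in C -> (forall x, x \in C -> (f a <= f x)%N) ->
    (forall u v, u \in C -> v \in C -> (f u < f v)%N ->
       (forall z, z \in C -> ~~ (f u < f z < f v)%N) -> (u \in I) || (v \in I)) ->
  wset w C - w a + (a \in I)%:R * w a <= 2 * wset w (I :&: C).
Proof.
move=> injf fw; have [n] := ubnP #|C|; elim: n C a => // n IH C a ltC aC mina cov.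
have wC : wset w C = w a + wset w (C :\ a) by rewrite /wset (big_setD1 a).
have wI : wset w (I :&: C) = (a \in I)%:R * w a + wset w (I :&: (C :\ a)).
  case aI: (a \in I).
    rewrite mul1r /wset (big_setD1 a) ?inE ?aI //=; congr (_ + _); apply: eq_bigl => x.
    by rewrite !inE; case: (x == a); rewrite ?andbF.
  rewrite mul0r add0r; congr wset; apply/setP => x; rewrite !inE.
  by case: eqP => // ->; rewrite aI.
case: (set_0Vmem (C :\ a)) => [E|[b0 b0C]].
  rewrite wC wI E setI0 /wset big_set0; have := w_ge0 a; case: (a \in I) => /=; lra.
case: (arg_minnP f b0C) => b bC minb.
have {bC} bC : b \in C :\ a := bC.
have ltn' : (#|C :\ a| < n)%N by rewrite (cardsD1 a C) aC in ltC.
have cov' u v : u \in C :\ a -> v \in C :\ a -> (f u < f v)%N ->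
    (forall z, z \in C :\ a -> ~~ (f u < f z < f v)%N) -> (u \in I) || (v \in I).
  rewrite !inE => /andP[ua uC] /andP[va vC] uv no.
  apply: cov => // z zC; case: (z =P a) => [->|/eqP za]; last by apply: no; rewrite !inE za.
  by rewrite ltnNge mina.
have {cov'} := IH _ b ltn' bC minb cov'.
have ab : (f a < f b)%N.
  move: bC; rewrite !inE => /andP[ba bC]; rewrite ltn_neqAle mina // andbT.
  by apply: contra ba => /eqP/injf->.
have bC' : b \in C by move: bC; rewrite !inE => /andP[].
have wab := fw _ _ ab; have wa := w_ge0 a; have wb := w_ge0 b.
(* What the induction hypothesis leaves to pay is [w b]; whichever of [a] and [b] lies in [I] pays
   it, as [w b <= w a]. *)
have: (a \in I) || (b \in I).
  apply: cov => // z zC; case: (z =P a) => [->|/eqP za]; first by rewrite ltnn.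
  have : z \in C :\ a by apply/setD1P.
  by move/minb; rewrite leqNgt => /negPf->; rewrite andbF.
rewrite wC wI; case: (a \in I); case: (b \in I) => //= _; lra.
Qed.

(** The factor 2 absorbs the halves in both zetas. Only the part of [I] inside [H] is charged, so
    that the bounds of disjoint components add up. *)
Definition orderable_bound H z := exists f, moral_order U H f /\
  forall I, covers U H f I -> z <= 2 * wset w (I :&: H).

Variable H : {set T}.
Hypothesis cH : chordal U H.

Lemma orderable_bound0 : orderable_bound H 0.
Proof.
have [||f [mf _ _]] := @moral_order_extend _ U H set0 (fun=> 0%N) (sub0set _).
- by split => x y; rewrite inE.
- move=> S; rewrite proper0 => Sn0 SH; rewrite setD0; exact: cH.
by exists f; split => // I _; rewrite mulr_ge0 // wset_ge0.
Qed.

Lemma orderable_bound_max x y : orderable_bound H x -> orderable_bound H y -> orderable_bound H (Num.max x y).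
Proof. by rewrite /Num.max; case: ifP. Qed.

(** A maximum equals one of its terms or the default 0, so the order may depend on the term. *)
Lemma orderable_bound_bigmax (J : finType) (P : pred J) (F : J -> R) :
  (forall j, P j -> orderable_bound H (F j)) ->
  orderable_bound H (\big[Num.max/0]_(j | P j) F j).
Proof. by move=> PF; apply: big_ind => //; [exact: orderable_bound0|exact: orderable_bound_max]. Qed.

Lemma orderable_bound_zeta1 : orderable_bound H (2 * zeta1 w U H).
Proof.
rewrite /zeta1 mulrA divff ?mul1r ?pnatr_eq0 //; apply: orderable_bound_bigmax => C /andP[cC Cn0].
have [CH clC] := cliqueP _ _ _ cC.
have [f0 [injf0 f0w]] := weight_order.
have [||f [mf fE fA]] := @moral_order_extend _ U H C f0 CH.
- by split => [x y _ _ /injf0 //|x y z xC yC zC _ _ _ _]; apply: clC.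
- move=> S CS SH; apply: chordal_simplicial_notin => //.
  + exact: chordalS cH.
  + by apply/cliqueP; split => //; apply: proper_sub.
  + by case/properP: CS => _ [x xS xC]; apply: contraNneq xC => ->.
exists f; split => // I covI.
case/set0Pn: (Cn0) => a0 a0C; case: (arg_minnP f0 a0C) => a aC mina.
(* All vertices of [C] are adjacent to both ends, so vertices consecutive in the order have the same
   other predecessors and span a covered edge. *)
have cov u v : u \in C -> v \in C -> (f0 u < f0 v)%N ->
    (forall z, z \in C -> ~~ (f0 u < f0 z < f0 v)%N) -> (u \in I) || (v \in I).
  move=> uC vC uv no.
  apply: covI; apply: covered_in_extend fE fA _ => //; split => //.
    by apply: clC => //; apply: contraTneq uv => ->; rewrite ltnn.
  move=> z zC zu; case: (z =P v) => [->|/eqP zv].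
    by rewrite irrU /= ltnNge (ltnW uv) andbF.
  rewrite !clC //=; have := no z zC; move: zu zv.
  rewrite -(inj_eq injf0) -(inj_eq injf0 z v); lia.
have := path_cover_bound injf0 f0w aC mina cov.
have: wset w (I :&: C) <= wset w (I :&: H) by apply: wsetS; apply: setIS.
have: w a <= \big[Num.max/0]_(v in C) w v by apply: le_bigmax_cond.
by have := w_ge0 a; case: (a \in I) => /=; lra.
Qed.

(** Optimal cliques are fixed for all [V] at once; the empty clique is always a candidate. *)
Lemma gamma_witness v : exists CC : {set T} -> {set T}, forall V : {set T},
  [/\ clique U H (CC V), CC V \subset V :&: nbr U H v &
      \big[Num.max/0]_(C : {set T} | clique U H C && (C \subset V :&: nbr U H v)) wset w C
        <= wset w (CC V)].
Proof.
pose ok (V C : {set T}) := [/\ clique U H C, C \subset V :&: nbr U H v &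
  \big[Num.max/0]_(C : {set T} | clique U H C && (C \subset V :&: nbr U H v)) wset w C
    <= wset w C].
suff: forall V, exists C, ok V C by case/fin_all_exists=> CC CCP; exists CC.
move=> V.
have P0 : clique U H set0 && (set0 \subset V :&: nbr U H v).
  by rewrite sub0set andbT; apply/cliqueP; split; rewrite ?sub0set // => x; rewrite inE.
case: (@arg_maxP _ _ _ set0 (fun C => clique U H C && (C \subset V :&: nbr U H v)) (wset w) P0)
  => C /andP[cC sC] maxC.
exists C; split => //; apply: bigmax_le => [|C' PC']; first exact: wset_ge0.
exact: maxC.
Qed.

Lemma orderable_bound_zeta2 : orderable_bound H (2 * zeta2 w U H).
Proof.
rewrite /zeta2 mulrA divff ?mul1r ?pnatr_eq0 //; apply: orderable_bound_bigmax => v vH.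
have [CC CCP] := gamma_witness v.
pose W := induced U (H :\ v).
have symW : connect_sym W.
  by apply: sym_connect_sym => x y; rewrite /W /induced symU [(y \in _) && _]andbC.
pose comp x := [set y | connect W x y].
have compE x y : y \in comp x -> comp x = comp y.
  by rewrite inE => xy; apply/setP => z; rewrite !inE (same_connect symW xy).
have compxx x : x \in comp x by rewrite inE.
have compU x y : x \in H -> x != v -> y \in H -> y != v -> U x y -> comp x = comp y.
  move=> xH xv yH yv xy; apply: compE; rewrite inE; apply: connect1.
  by rewrite /W /induced xy !inE xH xv yH yv.
have CCV V x : x \in CC V -> [/\ x \in V, x \in H & U v x].
  by case: (CCP V) => _ /subsetP sV _ /sV; rewrite !inE => /andP[-> /andP[-> ->]].
have CCv V x : x \in CC V -> x != v.
  by case/CCV=> _ _ vx; apply/eqP => E; rewrite E irrU in vx.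
have CCcl V x y : x \in CC V -> y \in CC V -> x != y -> U x y.
  by case: (CCP V) => /cliqueP[_ cl] _ _; apply: cl.
(* Membership of [x] in the clique chosen for its own component expresses the union of all chosen
   cliques. *)
pose A := v |: [set x | x \in CC (comp x)].
have AH : A \subset H.
  by apply/subsetP => x; rewrite !inE => /orP[/eqP->//|/CCV[]].
have memA x y : x \in CC (comp y) -> (comp x = comp y) /\ (x \in A).
  move=> xC; have [xy _ _] := CCV _ _ xC.
  by rewrite -(compE _ _ xy) !inE -(compE _ _ xy) xC orbT.
have nbrA x y : x \in A -> y \in CC (comp y) -> U x y -> x = v \/ x \in CC (comp y).
  rewrite !inE => /orP[/eqP->|xC] yC xy; [by left|right].
  have [_ xH _] := CCV _ _ xC; have [_ yH _] := CCV _ _ yC.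
  by rewrite -(compU x y) // (CCv _ _ xC, CCv _ _ yC).
have [g [injg gw]] := weight_order.
(* The shift by one reserves rank 0 for [v]. *)
pose f0 x := if x == v then 0%N else (g x).+1.
have f0v : f0 v = 0%N by rewrite /f0 eqxx.
have f0g x : x != v -> f0 x = (g x).+1 by rewrite /f0 => /negPf->.
have injf0 : injective f0.
  move=> x y; rewrite /f0; case: eqP => [->|_]; case: eqP => [->|_] //; case; exact: injg.
have [||f [mf fE fA]] := @moral_order_extend _ U H A f0 AH.
- split; first by move=> x y _ _ /injf0.
  move=> x y z xA yA; rewrite in_setU1 => /orP[/eqP->|]; first by rewrite f0v.
  rewrite inE => zC xz yz _ _ xy.
  case: (nbrA x z xA zC xz) xy => [->|xC]; case: (nbrA y z yA zC yz) => [->|yC].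
  + by rewrite eqxx.
  + by have [] := CCV _ _ yC.
  + by have [] := CCV _ _ xC; rewrite symU.
  + exact: CCcl xC yC.
- move=> S /properP[AS [x xS xA]] SH.
  have vA : v \in A by rewrite !inE eqxx.
  have xv : x != v by apply: contraNneq xA => ->.
  (* [A] need not be a clique, so the search is confined to [v] and one component, where [A] leaves
     just the clique [K]. A vertex found there other than [v] has all its neighbours in [S] inside
     [S'], so it is simplicial in [S] as well. *)
  pose S' := S :&: (v |: comp x); pose K := v |: CC (comp x).
  have xxC : x \notin CC (comp x) by move: xA; rewrite !inE negb_or => /andP[].
  have cK : clique U S' K.
    apply/cliqueP; split.
      apply/subsetP => y; rewrite in_setU1 => /orP[/eqP->|yC].
        by rewrite !inE eqxx (subsetP AS).
      by have [_ yA] := memA _ _ yC; have [] := CCV _ _ yC; rewrite !inE (subsetP AS) // => ->; rewrite orbT.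
    move=> y z; rewrite !in_setU1 => /orP[/eqP->|yC] /orP[/eqP->|zC]; rewrite ?eqxx //.
    + by have [] := CCV _ _ zC.
    + by have [] := CCV _ _ yC; rewrite symU.
    + exact: CCcl yC zC.
  have nK : K != S'.
    apply/eqP => E; have : x \in S' by rewrite !inE xS connect0 orbT.
    by rewrite -E in_setU1 (negPf xv) (negPf xxC).
  have [|y] := chordal_simplicial_notin symU irrU _ cK nK.
    by apply: chordalS cH; apply: subset_trans SH; apply: subsetIl.
  rewrite inE in_setU1 negb_or in_setI in_setU1 => /andP[/andP[yv yC]].
  rewrite (negPf yv) /= => /andP[yS yx] sy; exists y.
    by rewrite !inE yS (negPf yv) -(compE _ _ yx) yC.
  have inS' a : a \in S -> U a y -> a \in S'.
    move=> aS ay; rewrite inE aS in_setU1; case: (a =P v) => //= /eqP av.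
    by rewrite (compE _ _ yx) -(compU a y) // ?(subsetP SH).
  by move=> a b aS bS ay byy; apply: sy => //; apply: inS'.
exists f; split => // I covI.
have covA a b : covered_in U A f0 a b -> (a \in I) || (b \in I).
  by move=> cab; apply: covI; apply: covered_in_extend fE fA cab.
have vA : v \in A by rewrite !inE eqxx.
have covC x (C := CC (comp x)) a b : a \in C -> b \in C -> (g a < g b)%N ->
    (forall z, z \in C -> ~~ (g a < g z < g b)%N) -> (a \in I) || (b \in I).
  move=> aC bC ab no; have [Ea aA] := memA _ _ aC; have [Eb bA] := memA _ _ bC.
  have av := CCv _ _ aC; have bv := CCv _ _ bC.
  apply: covA; split => //; first by apply: CCcl aC bC _; apply: contraTneq ab => ->; rewrite ltnn.
    by rewrite !f0g.
  move=> z zA za; case: (z =P b) => [->|/eqP zb].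
    by rewrite irrU /= ltnNge (ltnW _) ?andbF // !f0g.
  case: (z =P v) => [->|/eqP zv].
    by have [_ _ ->] := CCV _ _ aC; have [_ _ ->] := CCV _ _ bC; rewrite f0v !f0g.
  have CE c : c \in C -> comp c = comp x -> z != c -> U z c = (z \in C).
    move=> cC Ec nzc; apply/idP/idP => [zc|zC]; last exact: CCcl zC cC nzc.
    have [||] := nbrA z c zA _ zc; rewrite ?Ec //.
    by move=> E; rewrite E eqxx in zv.
  rewrite !CE //; case zC: (z \in C) => //=; rewrite !f0g // !ltnS.
  have := no z zC; move: za zb; rewrite -(inj_eq injg) -(inj_eq injg z b).
  by clear -ab; lia.
case vI: (v \in I).
  rewrite ge_min; apply/orP; left.
  have: wset w [set v] <= wset w (I :&: H) by apply: wsetS; rewrite sub1set inE vI vH.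
  by rewrite {1}/wset big_set1; have := w_ge0 v; lra.
rewrite ge_min; apply/orP; right.
have bdC x (C := CC (comp x)) : wset w C <= 2 * wset w (I :&: C).
  case: (set_0Vmem C) => [->|[a0 a0C]].
    by rewrite setI0 /wset big_set0 mulr0.
  case: (arg_minnP g a0C) => a aC mina; have {aC} aC : a \in C := aC.
  have [Ea aA] := memA _ _ aC; have av := CCv _ _ aC; have [_ _ va] := CCV _ _ aC.
  (* [v] is the only parent of [a] within [A] and has none itself, so [v -> a] is covered. With [a]
     in [I] the loss of [w a] in [path_cover_bound] cancels. *)
  have aI : a \in I.
    suff: (v \in I) || (a \in I) by rewrite vI.
    apply: covA; split => //; first by rewrite f0v f0g.
    move=> z zA zv; rewrite f0v ltn0 andbF; apply/negP => /andP[za].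
    have [||] := nbrA z a zA _ za; rewrite ?Ea //; first by move/eqP: zv.
    by move=> zC; rewrite !f0g // ltnS ltnNge mina.
  have := path_cover_bound injg gw aC mina (@covC x).
  by rewrite aI mul1r subrK.
have cmem x : x \in H :\ v -> comp x \in comps_minus U H v by move=> xH; apply/imsetP; exists x.
apply: (@le_trans _ _ (\sum_(V in comps_minus U H v) 2 * wset w (I :&: CC V))).
  apply: ler_sum => V /imsetP[x _ ->].
  by apply: le_trans (bdC x); case: (CCP (comp x)).
rewrite -mulr_sumr ler_pM2l ?ltr0n //.
(* The cliques lie in distinct components, so their costs sum without overlap. *)
apply: (@le_trans _ _ (wset w (I :&: (H :\ v)))); last by apply: wsetS; rewrite setIS // subsetDl.
rewrite [leRHS](partition_big comp (fun V => V \in comps_minus U H v)) /=; last first.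
  by move=> x; rewrite inE => /andP[_ /cmem].
apply: ler_sum => V /imsetP[x0 _ EV].
have -> : \sum_(x in I :&: (H :\ v) | comp x == V) w x
    = wset w [set x in I :&: (H :\ v) | comp x == V].
  by apply: eq_bigl => x; rewrite [in RHS]inE.
apply: wsetS; apply/subsetP => x; case/setIP=> xI xC.
have [xV xH _] := CCV _ _ xC.
rewrite !inE xI xH (CCv _ _ xC) /=; apply/eqP; rewrite EV; apply: esym; apply: (compE x0); by rewrite /comp -EV.
Qed.

End Weights.

(** * Reorienting the chain components *)

Local Open Scope nat_scope.

Section Combine.
Variables (T : finType) (Gs : {set T * T}) (I : {set T}).
Hypothesis dGs : dag Gs.
Let O := essential Gs I.
Let cO : compat Gs O := essential_compat I dGs.
Let comp x := [set y | connect (und O) x y].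

(** The vertex of [S] ranked last by [Gs] is simplicial: its undirected neighbours in [S] are its
    parents, hence adjacent by [compat_moral], and no directed edge joins two vertices of one chain
    component. *)
Lemma essential_chordal H : chordal (und O) H.
Proof.
have [g Hg] := dag_rank dGs.
move=> S _ /set0Pn[x0 x0S]; case: (arg_maxnP g x0S) => x xS maxx; exists x => //.
have into y : y \in S -> und O y x -> erel Gs y x.
  move=> yS yx; case/orP: (compat_und cO yx) => // /Hg.
  by rewrite ltnNge => /negP[]; apply: maxx.
move=> y z yS zS yx zx yz.
have symO : connect_sym (und O) by apply: sym_connect_sym; exact: undC.
have conn : connect (und O) y z by apply: connect_trans (connect1 yx) _; rewrite symO connect1.
case: (adjp_cases (compat_moral cO yx (into _ yS yx) (into _ zS zx) yz)) => //.
  by move/(dir_not_connect dGs); rewrite conn.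
by move/(dir_not_connect dGs); rewrite symO conn.
Qed.

Variable F : {set T} -> T -> nat.
Hypothesis moralF : forall x, moral_order (und O) (comp x) (F (comp x)).

Let f x := F (comp x) x.

Definition reoriented : {set T * T} :=
  [set p | dir O p.1 p.2 || und O p.1 p.2 && (f p.1 < f p.2)].

Let reorientedE x y : erel reoriented x y = dir O x y || und O x y && (f x < f y).
Proof. by rewrite /erel inE. Qed.

Let symO : connect_sym (und O).
Proof. by apply: sym_connect_sym; exact: undC. Qed.

Let compE x y : connect (und O) x y -> comp x = comp y.
Proof. by move=> xy; apply/setP => z; rewrite !inE (same_connect symO xy). Qed.

Lemma reoriented_dag : dag reoriented.
Proof.
have [g Hg] := dag_rank dGs.
(* [m] is the least rank in the chain component. It is constant there and grows along directed
   edges, because an arc into a component reaches its minimizer too. *)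
have [m mle mex] : exists2 m : T -> nat, forall x y, connect (und O) x y -> m x <= g y &
    forall x, exists2 y, connect (und O) x y & m x = g y.
  exists (fun x => g [arg min_(y < x | connect (und O) x y) g y]) => x;
    case: arg_minnP; rewrite ?connect0 //.
  by move=> y xy _; exists y.
(* As [M] exceeds every [f y], the rank [m x * M + f x] is lexicographic. *)
pose M := (\max_(y : T) f y).+1.
have fM y : f y < M by rewrite ltnS leq_bigmax.
apply: (@rank_dag _ _ (fun x => m x * M + f x)) => x y.
rewrite reorientedE => /orP[xy|/andP[xy lt]].
  have lt : m x < m y.
    have [y' yy' ->] := mex y.
    apply: leq_ltn_trans (mle _ _ (connect0 _ _)) (Hg _ _ _).
    by apply: (compat_dir cO); exact: essential_chain_connect xy yy'.
  apply: (@leq_trans ((m x).+1 * M)); first by rewrite mulSn addnC ltn_add2r.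
  by apply: leq_trans (leq_addr _ _); rewrite leq_mul2r lt orbT.
suff -> : m x = m y by rewrite ltn_add2l.
apply/eqP; rewrite eqn_leq; apply/andP; split.
  by have [y' yy' ->] := mex y; apply: mle; apply: connect_trans (connect1 xy) yy'.
have [x' xx' ->] := mex x; apply: mle; apply: connect_trans xx'.
by rewrite symO connect1.
Qed.

(** Old v-structures consist of directed edges and survive. A new collider with one directed and one
    undirected edge is shielded by the chain property, one with two undirected edges by the moral
    order. *)
Lemma reoriented_mec : mec Gs reoriented.
Proof.
have adjE x y : adj Gs x y = adj reoriented x y.
  have [_ <- _] := cO; rewrite /adj !reorientedE; apply/idP/idP.
    case/adjp_cases=> [->//|->|xy]; first by rewrite orbT.
    rewrite [und O y x]undC xy /=.
    suff: f x != f y by rewrite neq_ltn => /orP[->|->]; rewrite !orbT.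
    have Exy := compE (connect1 xy).
    rewrite /f -Exy; apply: contra (compat_und_neq dGs cO xy) => /eqP E.
    by apply/eqP; apply: (proj1 (moralF x)); rewrite ?inE ?connect0 ?connect1.
  by case/orP=> /orP[/andP[xy _]|/andP[/andP[xy _] _]]; rewrite /adjp xy ?orbT.
have vs_dir x y z : vstruct Gs x y z -> dir O x y.
  case: cO => sub _ vs v; rewrite /dir (vs _ _ _ v) andbT; apply: sub.
  by case/andP: v.
have nadj x y : ~~ adj Gs x y -> ~~ adjp O x y by case: cO => _ ->.
apply/and3P; split; first exact: reoriented_dag.
  by apply/forallP => x; apply/forallP => y; rewrite adjE.
apply/forallP => x; apply/forallP => y; apply/forallP => z; apply/eqP.
apply/idP/idP => v.
  have xy := vs_dir _ _ _ v; have zy : dir O z y by apply: (vs_dir _ _ x); rewrite vstructC.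
  by case/and4P: v => _ _ xz nxz; apply/and4P; rewrite !reorientedE xy zy -adjE.
case/and4P: v; rewrite !reorientedE -adjE => xy zy xz nxz.
have nO := nadj _ _ nxz.
case/orP: xy => [xy|/andP[xy lxy]]; case/orP: zy => [zy|/andP[zy lzy]].
- by rewrite /vstruct (compat_dir cO xy) (compat_dir cO zy) xz.
- case/negP: nO; rewrite undC in zy.
  by have /andP[xz' _] := essential_chain dGs xy zy; apply/orP; left.
- case/negP: nO; rewrite undC in xy.
  by have /andP[xz' _] := essential_chain dGs zy xy; apply/orP; right.
case/negP: nO; apply: und_adjp.
have Exy : comp x = comp y := compE (connect1 xy).
have Ezy : comp z = comp y := compE (connect1 zy).
move: lxy lzy; rewrite /f Exy Ezy => lxy lzy.
have inH t : und O t y -> t \in comp y by move=> ty; rewrite inE symO connect1.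
by apply: (proj2 (moralF y)) (inH _ xy) (inH _ zy) _ xy zy lxy lzy xz; rewrite inE connect0.
Qed.

(** By the chain property an outside vertex points to all of a chain component or to none of it, so
    only parents inside the component can distinguish [u] from [v]. *)
Lemma reoriented_covered x0 u v :
  covered_in (und O) (comp x0) (F (comp x0)) u v -> covered reoriented u v.
Proof.
have fE z : z \in comp x0 -> F (comp x0) z = f z by rewrite inE => /compE E; rewrite /f -E.
case=> uH vH uv luv par; split; first by rewrite reorientedE uv -!fE // luv orbT.
move=> z zu; rewrite !reorientedE; congr (_ || _).
  have cuv := connect1 uv.
  apply/idP/idP => [zv|zu'].
    by apply: (essential_chain_connect dGs) zv _; rewrite symO.
  exact: (essential_chain_connect dGs) zu' cuv.
case zH: (z \in comp x0); first by rewrite -!fE // par.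
have out y : y \in comp x0 -> und O z y = false.
  move=> yH; apply/negP => zy; move: zH yH; rewrite !inE => /negP zH yH; apply: zH.
  by apply: connect_trans yH _; rewrite symO connect1.
by rewrite !out.
Qed.

End Combine.

Local Open Scope ring_scope.

Theorem mainTheorem3 (R : realFieldType) (T : finType) (w : T -> R)
  (Gs : {set T * T}) :
  (forall v : T, 0 <= w v) -> dag Gs ->
  lower_bound w Gs <= nu1max w Gs.
Proof.
move=> w_ge0 dGs; apply: bigmax_le => [|I _]; first exact: bigmax_ge_id.
set O := essential Gs I; set zeta := fun H => Num.max (zeta1 w (und O) H) (zeta2 w (und O) H).
have symO : symmetric (und O) by move=> x y; apply: undC.
have irrO : irreflexive (und O).
  by move=> x; apply/negP => /(compat_und_neq dGs (essential_compat I dGs)); rewrite eqxx.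
pose comp x := [set y | connect (und O) x y].
pose good H f := moral_order (und O) H f /\
  forall J, covers (und O) H f J -> zeta H <= wset w (J :&: H).
(* Orders are chosen for all vertex sets at once, since every set is chordal here; only those of
   chain components matter later. *)
have /fin_all_exists[F HF] : forall H, exists f, good H f.
  move=> H.
  have cH : chordal (und O) H by exact: essential_chordal.
  have [f [mf bf]] := orderable_bound_max (orderable_bound_zeta1 symO irrO w_ge0 cH) (orderable_bound_zeta2 symO irrO w_ge0 cH).
  exists f; split => // J /bf.
  by rewrite /zeta !ge_max !ler_pM2l ?ltr0n.
have [mF bF] := all_and2 HF.
pose G := reoriented Gs I F.
have mG : mec Gs G by apply: reoriented_mec => // x; apply: mF.
have dG : dag G by case/and3P: mG.
have bound J : (forall x, covers (und O) (comp x) (F (comp x)) J) ->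
    \sum_(H in chain_comps O | (1 < #|H|)%N) zeta H <= wset w J.
  move=> covJ.
  apply: (@le_trans _ _ (\sum_(H in chain_comps O) wset w (J :&: H))).
    rewrite big_mkcondr /=; apply: ler_sum => H /imsetP[x _ ->]; case: ifP => _.
      exact: bF (covJ x).
    exact: wset_ge0.
  rewrite [leRHS](partition_big comp (fun H => H \in chain_comps O)) /=; last first.
    by move=> x _; apply/imsetP; exists x.
  apply: ler_sum => H /imsetP[x0 _ EH].
  have -> : \sum_(x in J | comp x == H) w x = wset w [set x in J | comp x == H].
    by apply: eq_bigl => x; rewrite [in RHS]inE.
  apply: wsetS => //; apply/subsetP => x; rewrite !inE => /andP[-> /=].
  rewrite EH inE => cx; apply/eqP/setP => y.
  by rewrite !inE (same_connect (sym_connect_sym symO) cx).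
apply: le_trans (le_bigmax_cond _ _ mG).
(* The default [wset setT] of the minimum must be bounded as well; [setT] covers trivially. *)
apply: le_bigmin => [|J vJ]; apply: bound => x u v cuv; first by rewrite inE.
apply: (covered_edge_hit dG _ vJ); apply: reoriented_covered cuv => // y; exact: mF.
Qed.
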